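(* Let $X,Y$ be Banach spaces (over the same scalar field), and let $A\in\mathcal{B}(X,Y)$ and $B,C\in\mathcal{B}(Y,X)$ satisfy $ABA=ACA$. Then $\mathcal{R}(AC-I)$ is closed in $Y$ if and only if $\mathcal{R}(BA-I)$ is closed in $X$.
   Context: $\mathcal{B}(X,Y)$ denotes the bounded linear operators from $X$ to $Y$; $\mathcal{R}(T)$ denotes the range of an operator $T$; $I$ is the identity operator on the relevant space. *)

(* Defs.v *)
From HB Require Import structures.
From mathcomp Require Import all_boot all_order all_algebra.
From mathcomp Require Import all_classical all_reals all_analysis.
Set Implicit Arguments.
Unset Strict Implicit.
Unset Printing Implicit Defensive.
Import Order.TTheory GRing.Theory Num.Theory.
Import numFieldNormedType.Exports.
Local Open Scope classical_set_scope.
Local Open Scope ring_scope.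

Definition bounded_operator (K : numFieldType) (V W : normedModType K)
  (T : {linear V -> W}) : Prop :=
  exists M : K, forall x : V, `|T x| <= M * `|x|.

Lemma bounded_operatorP (K : numFieldType) (V W : normedModType K)
  (T : {linear V -> W}) : bounded_operator T <-> bounded_near T (nbhs 0).
Proof.
split=> [[M TM]|/linear_boundedP [M [Mreal TM]]]; last first.
  exists (M + 1) => x; apply: TM.
  by rewrite ltrDl ltr01.
apply/linear_boundedP; have [Mreal|Mnreal] := boolP (M \is Num.real).
  exists M; split=> // r Mr x; apply: le_trans (TM x) _.
  by rewrite ler_wpM2r // ltW.
exists 0; split; first exact: real0.
move=> r r0 x; have [->|x0] := eqVneq x 0.
  by rewrite linear0 !normr0 mulr0.
case/negP: Mnreal.
have xp : 0 < `|x| by rewrite normr_gt0.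
by apply: ger0_real; rewrite -(pmulr_lge0 _ xp); apply: le_trans (TM x).
Qed.

(* Main.v *)
(* Writing R(T) for the range of T, the hypothesis ABA = ACA gives
   R(AC - I) = (BAC)^-1 (R(BA - I)) and R(BA - I) = A^-1 (R(AC - I)).
   In each case one inclusion is an intertwining relation; the other one gives
   P^2 v \in R(P - I) for P = AC or P = BA, which forces v \in R(P - I) since
   P^2 - I factors through P - I.  Preimages of closed sets under the
   continuous maps BAC and A are closed. *)
Require Import Defs.
From HB Require Import structures.
From mathcomp Require Import all_boot all_order all_algebra.
From mathcomp Require Import all_classical all_reals all_analysis.
Import Order.TTheory GRing.Theory Num.Theory.
Import numFieldNormedType.Exports.
Local Open Scope classical_set_scope.
Local Open Scope ring_scope.

Lemma bounded_operator_continuous (K : numFieldType) (V W : normedModType K)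
    (T : {linear V -> W}) : bounded_operator T -> continuous T.
Proof. by rewrite bounded_operatorP linear_bounded_continuous. Qed.

Lemma range_sub_id_sqr (V : zmodType) (P : {additive V -> V}) (v : V) :
  range (P \- idfun) (P (P v)) -> range (P \- idfun) v.
Proof.
(* If [(P - I) w = P^2 v], then [v = P^2 v - (P^2 - I) v = (P - I) (w - P v - v)]. *)
move=> [w _ /= /(canRL (subrK w)) PwE]; exists (w - P v - v) => //=.
by rewrite !(raddfB P) /= PwE [P (P v) + w]addrC addrK subKr.
Qed.

Section SandwichedRanges.
Variables (X Y : zmodType) (A : {additive X -> Y}) (B C : {additive Y -> X}).
Hypothesis ABA_ACA : A \o B \o A =1 A \o C \o A.

Let ABAE x : A (B (A x)) = A (C (A x)). Proof. exact: ABA_ACA. Qed.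

Lemma range_AC_sub_id :
  range (A \o C \- idfun) = (B \o A \o C) @^-1` range (B \o A \- idfun).
Proof.
apply/seteqP; split=> [_ [z _ <-]|y [x _ /= xE]] /=.
  (* Intertwining: [BAC (AC - I) = (BA - I) BAC]. *)
  by exists (B (A (C z))) => //=; rewrite !raddfB /= ABAE.
apply: (@range_sub_id_sqr _ (A \o C : {additive Y -> Y})).
(* Applying [A] to [BAC y = (BA - I) x] gives [(AC)^2 y = (AC - I) A x]. *)
by exists (A x) => //=; rewrite -!ABAE -xE raddfB.
Qed.

Lemma range_BA_sub_id :
  range (B \o A \- idfun) = A @^-1` range (A \o C \- idfun).
Proof.
apply/seteqP; split=> [_ [w _ <-]|x [z _ /= zE]] /=.
  by exists (A w) => //=; rewrite raddfB /= ABAE.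
apply: (@range_sub_id_sqr _ (B \o A : {additive X -> X})).
(* Applying [BAC] to [A x = (AC - I) z] gives [(BA)^2 x = (BA - I) BAC z]. *)
by exists (B (A (C z))) => //=; rewrite !ABAE -zE !raddfB.
Qed.

End SandwichedRanges.

Theorem lemma2p1 (K : numFieldType) (X Y : completeNormedModType K)
    (A : {linear X -> Y}) (B C : {linear Y -> X})
    (bA : bounded_operator A) (bB : bounded_operator B)
    (bC : bounded_operator C)
    (ABA_ACA : A \o B \o A =1 A \o C \o A) :
  closed (range (A \o C \- idfun)) <-> closed (range (B \o A \- idfun)).
Proof.
have cA : continuous A by exact: bounded_operator_continuous.
have cB : continuous B by exact: bounded_operator_continuous.
have cC : continuous C by exact: bounded_operator_continuous.
split=> cl.
  rewrite (range_BA_sub_id _ _ _ _ _ ABA_ACA).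
  by apply: preimage_closed => // x _; exact: cA.
rewrite (range_AC_sub_id _ _ _ _ _ ABA_ACA).
apply: preimage_closed => // y _; apply: continuous_comp; first exact: cC.
by apply: continuous_comp; [exact: cA|exact: cB].
Qed.
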